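(* For every $w\in S_{\mathbb Z}$ and every partition $\lambda$, $$\sum_{\alpha\in\operatorname{Orb}(\lambda)}\overleftarrow{\kappa^w_\alpha}=[e_\lambda]F_w,$$ where $[e_\lambda]F_w$ is the coefficient of $e_\lambda$ in the expansion of the Stanley symmetric function $F_w$ in the elementary basis of $\Lambda$.
   Context: Ring. $\Lambda^-=\Lambda(\ldots,x_{-1},x_0)$ is the ring of symmetric functions over $\mathbb Q$ in the variables $x_i$, $i\le 0$, and $\mathcal R=\Lambda^-\otimes_{\mathbb Q}\mathbb Q[x_i\mid i\in\mathbb Z]$, identified via multiplication with a ring of bounded-degree formal power series in the variables $x_i$, $i\in\mathbb Z$. $\Lambda$ is the ring of symmetric functions over $\mathbb Q$ in $x_1,x_2,\ldots$. Back stable SEMs. $\mathcal C$ is the set of finitely supported tuples $\alpha=(\alpha_i)_{i\in\mathbb Z}$ of nonnegative integers. For $\alpha\in\mathcal C$, $\overleftarrow{\mathbf e}_\alpha=\prod_{i\in\mathbb Z}\mathbf e_{\alpha_i}(\ldots,x_{i-1},x_i)\in\mathcal R$, where $\mathbf e_d(\ldots,x_{k-1},x_k)$ is the elementary symmetric function in the variables $x_i$, $i\le k$. These form a $\mathbb Q$-basis of $\mathcal R$. For a partition $\lambda$, $\operatorname{Orb}(\lambda)$ is the set of $\alpha\in\mathcal C$ whose nonzero entries, sorted in weakly decreasing order, form $\lambda$. Permutations. $S_{\mathbb Z}$ is the group of permutations of $\mathbb Z$ moving only finitely many integers; $S_\infty\subset S_{\mathbb Z}$ is the subgroup of those fixing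 every $i\le 0$; $s_i=(i,i+1)$; $\ell$ is Coxeter length. The shift $\gamma$ acts by $\gamma(w)(i)=w(i-1)+1$ and $\gamma(x_i)=x_{i+1}$; for $w\in S_\infty$, $1^m\times w=\gamma^m(w)$. Schubert polynomials. For $w\in S_\infty$, $\mathfrak S_w$ is the usual Schubert polynomial: $\mathfrak S_{w_0}=x_1^{n-1}x_2^{n-2}\cdots x_{n-1}$ for the longest $w_0\in S_n$, and $\partial_i\mathfrak S_w=\mathfrak S_{ws_i}$ whenever $\ell(ws_i)<\ell(w)$, where $\partial_i f=(f-s_if)/(x_i-x_{i+1})$. For $w\in S_{\mathbb Z}$, $\overleftarrow{\mathfrak S}_w=\lim_{m\to\infty}\gamma^{-m}\big(\mathfrak S_{\gamma^m(w)}\big)\in\mathcal R$ (coefficientwise limit, over $m$ with $\gamma^m(w)\in S_\infty$). The coefficients $\overleftarrow{\kappa^w_\alpha}$ are defined by $\overleftarrow{\mathfrak S}_w=\sum_{\alpha\in\mathcal C}\overleftarrow{\kappa^w_\alpha}\,\overleftarrow{\mathbf e}_\alpha$. Stanley symmetric functions. For $w\in S_\infty$, $F_w=\lim_{m\to\infty}\mathfrak S_{1^m\times w}\in\Lambda$ (coefficientwise limit); this is extended to $w\in S_{\mathbb Z}$ by requiring $F_{\gamma(w)}=F_w$. *)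

(* Defs.v *)
From HB Require Import structures.
From mathcomp Require Import all_boot all_order all_algebra finmap.
From mathcomp Require Import boolp classical_sets functions cardinality fsbigop.
From mathcomp.multinomials Require Import monalg.

Set Implicit Arguments.
Unset Strict Implicit.
Unset Printing Implicit Defensive.

Import Order.TTheory GRing.Theory Num.Theory.

Local Open Scope classical_set_scope.
Local Open Scope ring_scope.

Definition in_SZ (w : int -> int) : Prop :=
  bijective w /\ finite_set [set i | w i != i].

Definition in_Soo (w : int -> int) : Prop :=
  in_SZ w /\ forall i, i <= 0 -> w i = i.

Definition stransp (i : int) : int -> int :=
  fun j => if j == i then i + 1 else if j == i + 1 then i else j.

(* Product of simple transpositions; permutations compose as functions, so
   that [w \o stransp i] is w s_i. *)
Definition word_perm (s : seq int) : int -> int :=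
  foldr (fun i u => stransp i \o u) id s.

(* Coxeter length: the least size of a word in the simple transpositions
   representing w; 0 when there is none, i.e. when w is not in S_Z. *)
Definition cox_length (w : int -> int) : nat :=
  if pselect (exists k, `[< exists2 s, size s = k & word_perm s = w >]) is left h
  then ex_minn h else 0%N.

(* gamma^k, for k : int. *)
Definition shift_perm (k : int) (w : int -> int) : int -> int :=
  fun i => w (i - k) + k.

(* w_0 in S_n. *)
Definition longest (n : nat) : int -> int :=
  fun i => if (1 <= i) && (i <= n%:Z) then n%:Z + 1 - i else i.

Notation mon := {cmonom int}.
Notation pol := {malg rat[mon]}.

Definition X (i : int) : pol := << ucm i >>.

(* The algebra morphism x_i |-> x_(sigma i); gamma^k is [rename] of
   translation by k, and s_i acts as [rename (stransp i)]. *)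
Definition rename (sigma : int -> int) (f : pol) : pol :=
  mmap (fun c : rat => c%:MP : pol)
       (fun m : mon => \prod_(i <- finsupp m) X (sigma i) ^+ m i) f.

(* g = (f - s_i f) / (x_i - x_(i+1)). *)
Definition is_divdiff (i : int) (f g : pol) : Prop :=
  (X i - X (i + 1)) * g = f - rename (stransp i) f.

(* The values of Sch outside S_oo are irrelevant. *)
Definition schubert_family (Sch : (int -> int) -> pol) : Prop :=
  (forall n : nat,
     Sch (longest n) = \prod_(1 <= j < n) X j%:Z ^+ (n - j)) /\
  (forall (w : int -> int) (i : int), in_Soo w -> 1 <= i ->
     (cox_length (w \o stransp i) < cox_length w)%N ->
     is_divdiff i (Sch w) (Sch (w \o stransp i))).

Notation series := (mon -> rat).

Definition sone : series := fun m => (m == mone)%:R.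

(* Cauchy product; each monomial has finitely many factorizations. *)
Definition smul (f g : series) : series := fun m =>
  \sum_(p \in [set p : mon * mon | mmul p.1 p.2 = m]) f p.1 * g p.2.

(* e_d in the variables x_i with i satisfying P: the sum of the squarefree
   monomials of degree d in these variables. *)
Definition elem (P : pred int) (d : nat) : series := fun m =>
  ((mdeg m == d) && all (fun i => P i && (m i == 1%N)) (finsupp m))%:R.

(* Coefficientwise limit of (u_k), k -> oo over the k with P k (an unbounded
   set in all uses): the eventual value of each coefficient, 0 if there is
   none. *)
Definition coef_lim (P : nat -> Prop) (u : nat -> pol) : series := fun m =>
  xget 0 [set c : rat | exists N : nat,
            forall k, (N <= k)%N -> P k -> (u k)@_m = c].

Definition back_stable (Sch : (int -> int) -> pol) (w : int -> int) : series :=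
  coef_lim (fun k => in_Soo (shift_perm k%:Z w))
           (fun k => rename (fun i => i - k%:Z) (Sch (shift_perm k%:Z w))).

(* For w in S_oo the side condition holds for all k and this is the limit of
   the Schubert polynomials of 1^k x w; see [stanley_shift] for the extension
   to S_Z. *)
Definition stanley (Sch : (int -> int) -> pol) (w : int -> int) : series :=
  coef_lim (fun k => in_Soo (shift_perm k%:Z w))
           (fun k => Sch (shift_perm k%:Z w)).

Lemma stanley_shift Sch w : stanley Sch (shift_perm 1 w) = stanley Sch w.
Proof.
have shS k : shift_perm k%:Z (shift_perm 1 w) = shift_perm k.+1%:Z w.
  apply/funext=> i; rewrite /shift_perm -[k.+1]addn1 PoszD opprD !addrA.
  by rewrite addrAC.
apply/funext=> m; apply: (congr1 (xget (0 : rat))).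
apply/seteqP; split=> c /= [N cN].
- exists N.+1 => -[//|k] Nk; rewrite -shS => wk; exact: cN.
- by exists N => k Nk; rewrite shS => wk; apply: cN => //; exact: leqW.
Qed.

(* The finitely supported tuples (alpha_i), i in Z. *)
Notation tuples := {fsfun int -> nat with 0%N}.

(* The factors with alpha_i = 0 are 1. *)
Definition sem (alpha : tuples) : series :=
  \big[smul/sone]_(i <- finsupp alpha) elem (fun j => j <= i) (alpha i).

Definition is_intpart (s : seq nat) : bool := sorted geq s && (0%N \notin s).
Notation intpart := {s : seq nat | is_intpart s}.

Definition e_part (lam : intpart) : series :=
  \big[smul/sone]_(d <- val lam) elem (fun j => 1 <= j) d.

Definition Orb (lam : intpart) : set tuples :=
  [set alpha : tuples | sort geq [seq alpha i | i <- finsupp alpha] = val lam].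

Definition lincomb (I : choiceType) (b : I -> series)
    (c : {fsfun I -> rat with 0}) : series :=
  fun m => \sum_(i <- finsupp c) c i * b i m.

(* Main.v *)
(* Setting x_1 = 0 in the Schubert polynomial of 1 x w and shifting the variables
   gives the Schubert polynomial of w: divided differences reduce this to w = w_0,
   where it is computed along a chain of descents from the longest element of
   S_(n+1) to 1 x w_0. Hence the coefficient of a monomial m in F_w is that of
   gamma^(-k) m in the back stable Schubert polynomial for all large k. For large k
   the monomial gamma^(-k) m only involves variables lying below the support of
   alpha, where the back stable SEM of alpha cannot be distinguished from the product
   of the elementary symmetric functions e_(alpha_i). So F_w is obtained from the
   back stable expansion by replacing each SEM by e_(sort alpha), and the algebraic
   independence of the elementary symmetric polynomials gives the result. *)

From HB Require Import structures.
Require Import Defs.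
From mathcomp Require Import all_boot all_order all_algebra finmap.
From mathcomp Require Import boolp classical_sets functions cardinality fsbigop.
From mathcomp Require Import zify.
From mathcomp.multinomials Require mpoly.
From mathcomp.multinomials Require Import monalg.

Set Implicit Arguments.
Unset Strict Implicit.
Unset Printing Implicit Defensive.

Import Order.TTheory GRing.Theory Num.Theory.

Local Open Scope classical_set_scope.
Local Open Scope ring_scope.

(** * Words in the simple transpositions and Coxeter length *)

Lemma stransp_inj i : injective (stransp i).
Proof. by move=> x y; rewrite /stransp; do ![case: eqP]; lia. Qed.

Lemma stranspK i : involutive (stransp i).
Proof. by move=> x; rewrite /stransp; do ![case: eqP]; lia. Qed.

Lemma comp_stranspK i (w : int -> int) : (w \o stransp i) \o stransp i = w.
Proof. by apply/funext => x; rewrite /= stranspK. Qed.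

Lemma word_perm_inj s : injective (word_perm s).
Proof. by elim: s => //= a s IHs; apply: inj_comp => //; apply: stransp_inj. Qed.

Lemma word_perm_cat s t : word_perm (s ++ t) = word_perm s \o word_perm t.
Proof. by elim: s => //= a s ->. Qed.

(* Follow the pair (i, i + 1) through the suffixes of the word: the letter at
   which it gets inverted can be deleted. *)
Lemma word_perm_exchange i s : word_perm s (i + 1) < word_perm s i ->
  exists2 s', (size s' < size s)%N & word_perm s' = word_perm s \o stransp i.
Proof.
elim: s => [|a s IHs] /=; first lia.
case: (ltrP (word_perm s (i + 1)) (word_perm s i)) => [/IHs[s' lts' es'] _|les].
  by exists (a :: s') => //=; rewrite es'.
move=> inv; exists s => //.
(* Composing with s_a can turn an ascent into an inversion only if the two values are a and a +
   1. *)
have [ua ub] : word_perm s i = a /\ word_perm s (i + 1) = a + 1.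
  have ne : word_perm s i <> word_perm s (i + 1) by move/word_perm_inj; lia.
  by move: inv; rewrite /stransp; do ![case: eqP]; lia.
apply/funext => x /=; rewrite {2}/stransp.
case: eqP => [->|xi]; first by rewrite ub ua /stransp; do ![case: eqP]; lia.
case: eqP => [->|xi1]; first by rewrite ub ua /stransp; do ![case: eqP]; lia.
have na : word_perm s x <> a by rewrite -ua => /word_perm_inj.
have nb : word_perm s x <> a + 1 by rewrite -ub => /word_perm_inj.
by rewrite /stransp; do ![case: eqP].
Qed.

Lemma cox_length_min s : (cox_length (word_perm s) <= size s)%N.
Proof.
rewrite /cox_length; case: pselect => // h; case: ex_minnP => k _; apply.
by apply/asboolP; exists s.
Qed.

Lemma cox_length_attained s :
  exists2 t, size t = cox_length (word_perm s) & word_perm t = word_perm s.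
Proof.
rewrite /cox_length; case: pselect => [h|[]].
  by case: ex_minnP => k /asboolP[t <- et] _; exists t.
by exists (size s); apply/asboolP; exists s.
Qed.

(** Exchange in a shortest word. This turns the length hypothesis of [schubert_family] into a
    comparison of two values. *)
Lemma cox_length_descent i s : word_perm s (i + 1) < word_perm s i ->
  (cox_length (word_perm s \o stransp i) < cox_length (word_perm s))%N.
Proof.
have [t <- <-] := cox_length_attained s => /word_perm_exchange[u ltut <-].
exact: leq_ltn_trans (cox_length_min u) ltut.
Qed.

(** * The symmetric groups S_n and their longest elements *)

Definition in_Sn (n : nat) (w : int -> int) : Prop :=
  injective w /\ forall i : int, ~~ (1 <= i <= n%:Z) -> w i = i.

Lemma in_Sn_range n w (i : int) : in_Sn n w -> 1 <= i <= n%:Z -> 1 <= w i <= n%:Z.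
Proof.
move=> [winj wfix] hi; apply/negPn/negP => nr.
by move: (nr); rewrite (winj _ _ (wfix _ nr)) hi.
Qed.

Lemma in_Sn_comp n v w : in_Sn n v -> in_Sn n w -> in_Sn n (v \o w).
Proof.
move=> [vinj vfix] [winj wfix]; split; first exact: inj_comp.
by move=> i ni /=; rewrite wfix // vfix.
Qed.

Lemma in_Sn_stransp (n : nat) (i : int) : 1 <= i < n%:Z -> in_Sn n (stransp i).
Proof.
move=> hi; split; first exact: stransp_inj.
by move=> j; rewrite /stransp; do ![case: eqP]; lia.
Qed.

Lemma in_Sn_longest n : in_Sn n (longest n).
Proof. by split=> [x y|i]; rewrite /longest; do ![case: ifP]; lia. Qed.

Lemma longestK n : involutive (longest n).
Proof. by move=> x; rewrite /longest; do ![case: ifP]; lia. Qed.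

(** There is no room: descents counted from the left force w(k+1) <= n - k, counted from the right
    w(n-k) >= k + 1, and together these fix every value. *)
Lemma longest_no_ascent n w : in_Sn n w ->
  (forall i : int, 1 <= i < n%:Z -> w (i + 1) < w i) -> w = longest n.
Proof.
move=> wS desc; have wr := in_Sn_range wS; have [winj wfix] := wS.
have up (k : nat) : (k < n)%N -> w (k%:Z + 1) <= n%:Z - k%:Z.
  elim: k => [|k IHk] kn; first by have := wr 1 ltac:(lia); rewrite add0r; lia.
  have := desc (k%:Z + 1) ltac:(lia); have := IHk (ltnW kn).
  have -> : k.+1%:Z = k%:Z + 1 by lia.
  lia.
have lo (k : nat) : (k < n)%N -> k%:Z + 1 <= w (n%:Z - k%:Z).
  elim: k => [|k IHk] kn; first by have := wr n%:Z ltac:(lia); rewrite subr0; lia.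
  have := desc (n%:Z - k.+1%:Z) ltac:(lia); have := IHk (ltnW kn).
  have -> : n%:Z - k.+1%:Z + 1 = n%:Z - k%:Z by lia.
  lia.
apply/funext => i; rewrite /longest; case: ifP => hi; last by apply: wfix; lia.
have := up `|i - 1|%N ltac:(lia); have := lo `|n%:Z - i|%N ltac:(lia).
have -> : (`|n%:Z - i|%N)%:Z = n%:Z - i by lia.
have -> : (`|i - 1|%N)%:Z = i - 1 by lia.
have -> : n%:Z - (n%:Z - i) = i by lia.
have -> : i - 1 + 1 = i by lia.
lia.
Qed.

(* Induction downwards from the longest element; the measure is the sum of the
   i * w i, which decreases when an ascent is swapped. *)
Lemma in_Sn_ind (n : nat) (P : (int -> int) -> Prop) : P (longest n) ->
  (forall w (i : int), in_Sn n w -> 1 <= i < n%:Z -> w i < w (i + 1) ->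
     P (w \o stransp i) -> P w) ->
  forall w, in_Sn n w -> P w.
Proof.
move=> P0 PS w.
pose M (v : int -> int) : int := \sum_(1 <= j < n.+1) j%:Z * v j%:Z.
have [k] := ubnP `|M w|%N; elim: k w => // k IHk w lek wS.
have M_ge0 v : in_Sn n v -> 0 <= M v.
  move=> vS; rewrite /M big_nat; apply: sumr_ge0 => j hj.
  by apply: mulr_ge0 => //; have := @in_Sn_range _ _ j%:Z vS ltac:(lia); lia.
case: (pselect (exists2 i, 1 <= i < n%:Z & w i < w (i + 1))) => [[i hi asc]|nasc].
  have wS' := in_Sn_comp wS (in_Sn_stransp hi).
  apply: (PS w i) => //; apply: IHk => //.
  suff : M (w \o stransp i) < M w by have := M_ge0 _ wS; have := M_ge0 _ wS'; lia.
  (* Only the terms of index j and j + 1 change, and their sum drops by w(j+1) - w(j). *)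
  have [j ei] : exists j : nat, i = j%:Z by exists `|i|%N; lia.
  subst i; rewrite /M (@big_cat_nat _ _ _ j) /=; [|lia|lia].
  rewrite [ltRHS](@big_cat_nat _ _ _ j) /=; [|lia|lia].
  have -> : \sum_(1 <= l < j) l%:Z * w (stransp j%:Z l%:Z)
          = \sum_(1 <= l < j) l%:Z * w l%:Z.
    by apply: eq_big_nat => l hl; rewrite /stransp; do ![case: eqP => ?]; lia.
  rewrite ltrD2l big_ltn ?[ltRHS]big_ltn; [|lia|lia].
  rewrite big_ltn ?[X in _ < _ + X]big_ltn; [|lia|lia].
  have -> : \sum_(j.+2 <= l < n.+1) l%:Z * w (stransp j%:Z l%:Z)
          = \sum_(j.+2 <= l < n.+1) l%:Z * w l%:Z.
    by apply: eq_big_nat => l hl; rewrite /stransp; do ![case: eqP => ?]; lia.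
  have -> : stransp j%:Z j%:Z = j%:Z + 1 by rewrite /stransp eqxx.
  have -> : stransp j%:Z j.+1%:Z = j%:Z by rewrite /stransp; do ![case: eqP]; lia.
  have -> : j.+1%:Z = j%:Z + 1 by lia.
  by rewrite !addrA ltrD2r !mulrDl !mul1r addrCA !ltrD2l.
rewrite (longest_no_ascent wS) // => i hi.
have [winj _] := wS; case: (ltrP (w (i + 1)) (w i)) => // le.
case: nasc; exists i => //; rewrite lt_neqAle le andbT.
by apply/eqP => /winj; lia.
Qed.

(** The induction is run on the predicate for [longest n \o v], which is the identity in the base
    case, and applied at v = [longest n \o w]; [longest n] is an involution. *)
Lemma in_Sn_word n w : in_Sn n w -> exists s, word_perm s = w.
Proof.
move=> wS; suff [s es] : exists s, word_perm s = longest n \o (longest n \o w).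
  by exists s; rewrite es; apply/funext => x /=; rewrite longestK.
apply: (@in_Sn_ind n (fun v => exists s, word_perm s = longest n \o v));
  last by apply: in_Sn_comp => //; apply: in_Sn_longest.
  by exists [::]; apply/funext => x /=; rewrite longestK.
move=> v i _ _ _ [s es]; exists (s ++ [:: i]); rewrite word_perm_cat es.
by apply/funext => x /=; rewrite stranspK.
Qed.

Lemma in_Sn_cox_length_descent n w i : in_Sn n w -> w (i + 1) < w i ->
  (cox_length (w \o stransp i) < cox_length w)%N.
Proof. by move=> /in_Sn_word[s <-]; apply: cox_length_descent. Qed.

(** * Bounded supports and shifts of permutations *)

Lemma in_SZ_bound w : in_SZ w -> exists N : nat, forall i, (N < `|i|)%N -> w i = i.
Proof.
move=> [_ /finite_seqP[s es]]; exists (\max_(i <- s) `|i|%N)%N => i.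
apply: contraTeq => wi; rewrite -leqNgt.
have si : i \in s by have : [set` s] i by rewrite -es.
exact: (@leq_bigmax_seq _ s xpredT (fun j : int => `|j|%N)).
Qed.

Lemma in_Soo_Sn w : in_Soo w -> exists n, in_Sn n w.
Proof.
move=> [wSZ wfix]; have [N wN] := in_SZ_bound wSZ; exists N; split.
  by case: wSZ => /bij_inj.
by move=> i hi; case: (lerP i 0) => [/wfix //|i0]; apply: wN; lia.
Qed.

Lemma in_Sn_Soo n w : in_Sn n w -> in_Soo w.
Proof.
move=> wS; have [s es] := in_Sn_word wS; have [_ wfix] := wS.
split; last by move=> i i0; apply: wfix; lia.
split.
  rewrite -es; elim: s {es} => [|a s IHs] /=; first by exists id.
  by apply: bij_comp IHs; exists (stransp a); apply: stranspK.
apply: (@sub_finite_set _ _ [set` [seq j%:Z | j <- iota 1 n]]); last first.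
  exact: finite_seq.
move=> i /= /eqP wi; apply/mapP; exists `|i|%N.
  by rewrite mem_iota; have := wfix i; lia.
by have := wfix i; lia.
Qed.

Lemma shift_permD (j k : int) w :
  shift_perm j (shift_perm k w) = shift_perm (k + j) w.
Proof. by apply/funext => i; rewrite /shift_perm addrA; congr (w _ + _ + _); lia. Qed.

Lemma in_SZ_shift w k : in_SZ w -> in_SZ (shift_perm k w).
Proof.
move=> [wbij wfin]; split.
  apply: (@bij_comp _ _ _ (fun x => x + k) (fun x => w (x - k))).
    by exists (fun x => x - k) => x; rewrite (addrK, subrK).
  apply: (@bij_comp _ _ _ w (fun x => x - k)) => //.
  by exists (fun x => x + k) => x; rewrite (addrK, subrK).
apply: (@sub_finite_set _ _ [set i + k | i in [set i | w i != i]]); last first.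
  exact: finite_image.
move=> i /= wi; exists (i - k); last by rewrite subrK.
by move: wi; rewrite /shift_perm; lia.
Qed.

Lemma in_Soo_shift_near w : in_SZ w ->
  exists K : nat, forall k, (K <= k)%N -> in_Soo (shift_perm k%:Z w).
Proof.
move=> wSZ; have [N wN] := in_SZ_bound wSZ; exists N.+1 => k Nk.
split; first exact: in_SZ_shift.
by move=> i i0; rewrite /shift_perm wN; lia.
Qed.

Lemma in_Soo_shift (k : nat) w : in_Soo w -> in_Soo (shift_perm k%:Z w).
Proof.
move=> [wSZ wfix]; split; first exact: in_SZ_shift.
by move=> i i0; rewrite /shift_perm wfix; lia.
Qed.

(** * Substitutions and shifts of monomials *)

Definition monom_eval (v : int -> pol) (m : mon) : pol :=
  \prod_(i <- finsupp m) v i ^+ m i.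

Lemma monom_evalEw (d : {fset int}) v (m : mon) : (finsupp m `<=` d)%fset ->
  monom_eval v m = \prod_(i <- d) v i ^+ m i.
Proof.
move=> le; rewrite /monom_eval (big_fset_incl _ le) //= => i _.
by rewrite -cmE_eq0 => /eqP ->; rewrite expr0.
Qed.

Lemma monom_eval_mmorphism v : mmorphism (monom_eval v).
Proof.
split=> [x y|]; last by rewrite /monom_eval mdom1 big_seq_fset0.
rewrite !(@monom_evalEw (finsupp x `|` finsupp y)%fset) ?fsubsetUl ?fsubsetUr //.
  by rewrite -big_split; apply: eq_bigr => i _; rewrite cmM exprD.
by rewrite mdomD fsubset_refl.
Qed.

HB.instance Definition _ v :=
  monalg.isMultiplicative.Build _ _ (monom_eval v) (monom_eval_mmorphism v).

(** Renamings and specializations at zero are both instances, so identities between their composites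
    can be checked on the variables. *)
Definition evalm (v : int -> pol) (f : pol) : pol :=
  mmap (fun c : rat => c%:MP : pol) (monom_eval v) f.
HB.instance Definition _ v := GRing.RMorphism.copy (evalm v)
   (mmap (@malgC mon rat : rat -> pol) (monom_eval v)).

Lemma evalmE v f :
  evalm v f = \sum_(m <- msupp f) (f@_m)%:MP * monom_eval v m.
Proof. by []. Qed.

Lemma evalmX v i : evalm v (X i) = v i.
Proof. by rewrite /evalm /X mmapU /monom_eval mdomU big_seq_fset1 cmUU mul1r. Qed.

Lemma evalmC v c : evalm v c%:MP = c%:MP.
Proof. exact: mmapC. Qed.

Lemma renameE sigma : rename sigma = evalm (X \o sigma).
Proof. by []. Qed.

Lemma evalm_comp u v f : evalm u (evalm v f) = evalm (evalm u \o v) f.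
Proof.
rewrite [evalm v f]evalmE [RHS]evalmE rmorph_sum; apply: eq_bigr => m _.
rewrite rmorphM /= evalmC; congr (_ * _).
by rewrite /monom_eval rmorph_prod; apply: eq_bigr => i _; rewrite rmorphXn.
Qed.

Lemma eq_evalm u v : u =1 v -> evalm u =1 evalm v.
Proof. by move=> uv f; rewrite (funext uv). Qed.

Definition shift_mon (k : int) (m : mon) : mon :=
  [cmonom m (i - k)%R | i in [fset (i + k)%R | i in finsupp m]%fset]%M.

Lemma shift_monE k m i : shift_mon k m i = m (i - k).
Proof.
rewrite cmE fsfun_fun; case: ifP => // /negbT ni; apply/esym/eqP.
rewrite cmE_eq0; apply: contra ni => mi; apply/imfsetP; exists (i - k) => //.
by rewrite subrK.
Qed.

Lemma shift_monD (j k : int) m : shift_mon j (shift_mon k m) = shift_mon (k + j) m.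
Proof. by apply/eqP/cmP => i; rewrite !shift_monE; congr (m _); lia. Qed.

Lemma shift_mon0 m : shift_mon 0 m = m.
Proof. by apply/eqP/cmP => i; rewrite shift_monE subr0. Qed.

Lemma prod_ucm (I : Type) (r : seq I) (F : I -> mon) :
  \prod_(i <- r) << F i >> = << \big[mmul/mone]_(i <- r) F i >> :> pol.
Proof.
elim: r => [|i r IHr]; first by rewrite !big_nil.
by rewrite !big_cons IHr; apply: etrans (fgmulUU _ _ _ _) _; congr mkmalgU.
Qed.

Lemma cm_bigE (I : Type) (r : seq I) (F : I -> mon) j :
  (\big[mmul/mone]_(i <- r) F i) j = (\sum_(i <- r) F i j)%N.
Proof. by elim/big_rec2: _ => [|i x m _ <-]; rewrite ?cm1 ?cmM. Qed.

Lemma monom_eval_shift k m :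
  monom_eval (fun i => X (i + k)) m = << shift_mon k m >>.
Proof.
rewrite /monom_eval.
have XE i n : X i ^+ n = << \big[mmul/mone]_(0 <= l < n) ucm i >>.
  by rewrite -prod_ucm prodr_const_nat subn0.
under eq_bigr do rewrite XE.
rewrite prod_ucm; congr << _ >>; apply/eqP/cmP => j; rewrite shift_monE cm_bigE.
under eq_bigr do rewrite cm_bigE sum_nat_const_nat subn0 cmU.
have [mj|mj] := boolP (j - k \in finsupp m).
  rewrite (big_fsetD1 _ mj) /= subrK eqxx muln1 big1_seq ?addn0 // => i /=.
  rewrite !inE => /andP[ni _]; case: eqP => [e|]; last by rewrite muln0.
  by rewrite -e addrK eqxx in ni.
rewrite big1_seq; first by apply/esym/eqP; rewrite cmE_eq0.
move=> i /= mi; case: eqP => [e|]; last by rewrite muln0.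
by rewrite -e addrK mi in mj.
Qed.

(** * Coefficients of products and renamings *)

Lemma mulXE i f : X i * f = \sum_(m <- msupp f) << f@_m *g mmul (ucm i) m >>.
Proof.
by apply: etrans (fgmulUg _ _ _) _; apply: eq_bigr => m _; rewrite mul1r.
Qed.

Lemma mcoeff_ucmM i f m : (X i * f)@_(mmul (ucm i) m) = f@_m.
Proof.
rewrite mulXE [in RHS](monalgE f) !raddf_sum /=; apply: eq_bigr => k _.
rewrite !mcoeffU; congr (_ *+ nat_of_bool _).
apply/eqP/eqP => [/eqP/cmP e|->//]; apply/eqP/cmP => j.
by have := e j; rewrite !cmM => /addnI.
Qed.

Lemma mcoeff_XM0 i f (m : mon) : m i = 0%N -> (X i * f)@_m = 0.
Proof.
move=> mi; rewrite mulXE raddf_sum big1 // => k _ /=.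
rewrite mcoeffU; case: eqP => // /eqP/cmP/(_ i).
by rewrite mi cmM cmUU.
Qed.

(** If x_i d = x_j d, the coefficient of d at m equals the one at m x_i / x_j; repeating this lowers
    the exponent of x_j to 0, where the coefficient vanishes. Divided differences are thereby
    unique. *)
Lemma mulX_subr_inj i j : i != j -> injective ( *%R (X i - X j)).
Proof.
move=> nij f g /= /eqP; rewrite -subr_eq0 -mulrBr mulrBl subr_eq0 => /eqP.
move: (f - g) (subr0_eq (x := f) (y := g)) => d fg e; apply: fg.
apply/malgP => m; rewrite mcoeff0.
have {}e l : (X i * d)@_l = (X j * d)@_l := congr1 (mcoeff l) e.
have [n] := ubnP (m j); elim: n m => // n IHn m lem.
rewrite -(mcoeff_ucmM i) e; have [mj0|mj] := posnP (m j).
  by rewrite mcoeff_XM0 // cmM mj0 cmU (negbTE nij).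
have -> : mmul (ucm i) m = mmul (ucm j) (mmul (ucm i) (divcm m (ucm j))).
  apply/eqP/cmP => l; rewrite !cmM divcmE [ucm j l]cmU; case: eqP => [<-|_] /=;
    last by rewrite subn0.
  by rewrite subn1 addnCA add1n prednK.
rewrite mcoeff_ucmM; apply: IHn; rewrite cmM divcmE cmUU cmU (negbTE nij); lia.
Qed.

Lemma mcoeff_rename_shift k f m :
  (rename (fun i => i + k) f)@_(shift_mon k m) = f@_m.
Proof.
rewrite renameE evalmE raddf_sum /= [in RHS](monalgE f) raddf_sum /=.
apply: eq_bigr => l _; rewrite mcoeffCM (monom_eval_shift k) mcoeffU1 mcoeffU -[RHS]mulr_natr.
congr (_ * (nat_of_bool _)%:R); apply/eqP/eqP => [/eqP/cmP e|->//].
by apply/eqP/cmP => i; have := e (i + k); rewrite !shift_monE addrK.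
Qed.

(** * Setting a variable to zero *)

Definition kill (p : int) (i : int) : pol := if i == p then 0 else X i.

Lemma mcoeff_kill p f (m : mon) : m p = 0%N -> (evalm (kill p) f)@_m = f@_m.
Proof.
move=> mp; rewrite evalmE raddf_sum /= [in RHS](monalgE f) raddf_sum /=.
apply: eq_bigr => l _; rewrite mcoeffCM mcoeffU -[RHS]mulr_natr; congr (_ * _).
have [lp0|lp] := posnP (l p).
  rewrite -[l in RHS]shift_mon0 -mcoeffU1 -monom_eval_shift /monom_eval.
  apply: (congr1 (mcoeff m)); apply: eq_big_seq => i; rewrite -cmE_neq0 /kill addr0.
  by case: (i =P p) => [->|_ _]; [rewrite lp0 | exact: erefl].
rewrite /monom_eval (big_fsetD1 p) /=; last by rewrite -cmE_neq0 -lt0n.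
rewrite /kill eqxx expr0n (gtn_eqF lp) mul0r mcoeff0.
have -> : (l == m) = false by apply/eqP => lm; move: lp; rewrite lm mp.
by rewrite mulr0n.
Qed.

Lemma evalm_divdiff v i j f g h : (X i - X j) * g = f - h ->
  (v i - v j) * evalm v g = evalm v f - evalm v h.
Proof.
move=> /(congr1 (evalm v)) e.
by rewrite -rmorphB -(evalmX v i) -(evalmX v j) -rmorphB -rmorphM.
Qed.

Lemma evalm_square u v u' v' f : (forall i, evalm u (v i) = evalm u' (v' i)) ->
  evalm u (evalm v f) = evalm u' (evalm v' f).
Proof. by move=> e; rewrite !evalm_comp; apply: eq_evalm. Qed.

Lemma evalm_kill_rename (j k : int) f : j != k -> j != k + 1 ->
  evalm (kill j) (rename (stransp k) f) = rename (stransp k) (evalm (kill j) f).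
Proof.
move=> jk jk1; apply: evalm_square => i.
rewrite /= evalmX /kill /stransp; have [->|ij] := eqVneq i j.
  by rewrite (negbTE jk) (negbTE jk1) eqxx rmorph0.
rewrite evalmX /= /stransp; case: (eqVneq i k) => [ik|ik].
  by rewrite eq_sym (negbTE jk1).
case: (eqVneq i (k + 1)) => [ik1|ik1]; first by rewrite eq_sym (negbTE jk).
by rewrite (negbTE ij).
Qed.

(** Both sides send x_(k+1) to 0 and x_k to x_(k+1). *)
Lemma evalm_kill_rename_succ (k : int) f :
  evalm (kill k) (rename (stransp k) f) =
  rename (stransp k) (evalm (kill (k + 1)) f).
Proof.
have k1k : (k + 1 == k) = false by lia.
apply: evalm_square => i.
rewrite /= evalmX /kill /stransp; have [->|ij] := eqVneq i (k + 1).
  by rewrite k1k eqxx rmorph0.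
rewrite evalmX /= /stransp; case: (eqVneq i k) => [ik|ik].
  by rewrite k1k.
by rewrite (negbTE ik) (negbTE ij).
Qed.

(** * The chain from w_0 of S_(n+1) down to 1 x w_0 *)

(* In one-line notation [n+1, ..., n+3-k, 1, n+2-k, ..., 2], with 1 at position k;
   interpolates between w_0 of S_(n+1) (k = n + 1) and 1 x w_0 of S_n (k = 1). *)
Definition longest_move (n : nat) (k : int) : int -> int := fun j =>
  if ~~ (1 <= j <= n%:Z + 1) then j
  else if j < k then n%:Z + 2 - j
  else if j == k then 1 else n%:Z + 3 - j.

Lemma longest_move_last n : longest_move n (n%:Z + 1) = longest n.+1.
Proof. by apply/funext => j; rewrite /longest_move /longest; do ![case: ifP]; lia. Qed.

Lemma longest_move_first n : longest_move n 1 = shift_perm 1 (longest n).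
Proof.
apply/funext => j; rewrite /shift_perm /longest_move /longest.
by do ![case: ifP]; lia.
Qed.

Lemma longest_move_stransp n (k : int) : 1 <= k <= n%:Z ->
  longest_move n (k + 1) \o stransp k = longest_move n k.
Proof.
move=> hk; apply/funext => j; rewrite /longest_move /stransp /=.
by do ![case: ifP]; lia.
Qed.

Lemma longest_move_Sn n (k : int) : 1 <= k <= n%:Z + 1 ->
  in_Sn n.+1 (longest_move n k).
Proof.
move=> hk; split=> [i j|i hi]; rewrite /longest_move; last by case: ifP; lia.
by do ![case: ifP]; lia.
Qed.

Lemma longest_move_descent n (k : int) : 1 <= k <= n%:Z ->
  longest_move n (k + 1) (k + 1) < longest_move n (k + 1) k.
Proof. by move=> hk; rewrite /longest_move; do ![case: ifP]; lia. Qed.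

(** The staircase monomial of S_(n+1) without its k-th factor: complete for k = n + 1, and for k = 1
    the shift of the staircase monomial of S_n. The ring and the x_i are arbitrary so that
    substitutions can be applied. *)
Definition staircase (R : comNzRingType) (x : int -> R) (n : nat) (k : int) : R :=
  \prod_(1 <= j < n.+2) (if j%:Z == k then 1 else x j%:Z ^+ (n.+1 - j)).

Lemma mulX_inj i : injective ( *%R (X i)).
Proof.
move=> f g /= e; apply/malgP => m; rewrite -(mcoeff_ucmM i f) -(mcoeff_ucmM i g).
exact: (congr1 (mcoeff (mmul (ucm i) m)) e).
Qed.

Lemma prod_expn_subn (R : comNzRingType) (x : nat -> R) n :
  \prod_(1 <= j < n.+1) x j ^+ (n - j) = \prod_(1 <= j < n) x j ^+ (n - j).
Proof.
case: n => [|n]; first by rewrite !big_geq.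
by rewrite big_nat_recr //= subnn expr0 mulr1.
Qed.

(** The exchange turns x_k^(n+1-k) into x_(k+1)^(n+1-k), which has one x_(k+1) more than the factor
    x_(k+1)^(n-k) on the right. *)
Lemma staircase_stransp (R : comNzRingType) (x : int -> R) (n : nat) (k : int) :
  1 <= k <= n%:Z ->
  staircase (x \o stransp k) n (k + 1) = x (k + 1) * staircase x n k.
Proof.
move=> hk; have [j ej] : exists j : nat, k = j%:Z by exists `|k|%N; lia.
subst k; rewrite /staircase.
have split3 (F : nat -> R) : \prod_(1 <= l < n.+2) F l =
    \prod_(1 <= l < j) F l * (F j * (F j.+1 * \prod_(j.+2 <= l < n.+2) F l)).
  have j1 : (1 <= j)%N by lia.
  have jn : (j <= n)%N by lia.
  rewrite (@big_cat_nat _ _ _ j) //=; last by rewrite !leqW.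
  have j2 : (j < n.+2)%N by rewrite ltnS leqW.
  have j3 : (j.+1 < n.+2)%N by rewrite !ltnS.
  by rewrite (big_ltn j2) (big_ltn j3).
rewrite !split3 [RHS]mulrCA; congr (_ * _).
  apply: eq_big_nat => l hl /=; rewrite /stransp.
  by do ![case: eqP => ?]; by [lia | congr (x _ ^+ _); lia].
rewrite /=.
have -> : (j%:Z == j%:Z + 1) = false by lia.
have -> : (j.+1%:Z == j%:Z + 1) by lia.
have -> : (j.+1%:Z == j%:Z) = false by lia.
rewrite eqxx !mul1r mulrA -[in RHS]PoszD addn1.
have -> : stransp j%:Z j%:Z = j.+1%:Z by rewrite /stransp eqxx; lia.
rewrite -exprS subSn; last lia.
rewrite subSS; congr (_ * _).
apply: eq_big_nat => l hl; rewrite /stransp.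
by do ![case: eqP => ?]; by [lia | congr (x _ ^+ _); lia].
Qed.

Lemma evalm_staircase v n k :
  evalm v (staircase X n k) = staircase v n k.
Proof.
rewrite rmorph_prod; apply: eq_bigr => j _.
case: (_ == _); first by rewrite rmorph1.
by rewrite rmorphXn /= evalmX.
Qed.

(** * Stability of Schubert polynomials under the shift *)

Section SchubertStability.
Variable Sch : (int -> int) -> pol.
Hypothesis hSch : schubert_family Sch.

Lemma schubert_divdiff n w i : in_Sn n w -> 1 <= i -> w (i + 1) < w i ->
  (X i - X (i + 1)) * Sch (w \o stransp i) = Sch w - rename (stransp i) (Sch w).
Proof.
move=> wS i1 desc; apply: (proj2 hSch) => //; first exact: in_Sn_Soo wS.
exact: in_Sn_cox_length_descent wS desc.
Qed.

Lemma schubert_longest n : Sch (longest n.+1) = staircase X n (n%:Z + 1).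
Proof.
rewrite (proj1 hSch) /staircase [RHS]big_nat_recr //=.
rewrite -PoszD addn1 eqxx mulr1; apply: eq_big_nat => j hj.
by rewrite ifF //; lia.
Qed.

(* Since x_k divides the Schubert polynomial f of [longest_move n (k + 1)], setting
   x_k = 0 in (x_k - x_(k+1)) g = f - s_k f leaves x_(k+1) g = s_k (f at x_(k+1) = 0). *)
Lemma kill_schubert_longest_move (n d : nat) : (d <= n)%N ->
  let k := n%:Z + 1 - d%:Z in
  (forall j : int, 1 <= j < k -> evalm (kill j) (Sch (longest_move n k)) = 0) /\
  evalm (kill k) (Sch (longest_move n k)) = staircase X n k.
Proof.
elim: d => [|d IHd] dn /=.
  rewrite subr0 longest_move_last schubert_longest; split=> [j hj|].
    rewrite evalm_staircase /staircase.
    have hj' : `|j|%N \in index_iota 1 n.+2 by rewrite mem_index_iota; lia.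
    rewrite (bigD1_seq _ hj') ?iota_uniq //=.
    have -> : (`|j|%N)%:Z = j by lia.
    rewrite ifF; last lia.
    have nj : (n.+1 - `|j| == 0)%N = false by lia.
    by rewrite /kill eqxx expr0n nj mulr0n mul0r.
  rewrite evalm_staircase; apply: eq_big_nat => j hj.
  by rewrite /kill; case: (_ == _).
have [IH0 IH1] := IHd (ltnW dn).
have ek : n%:Z + 1 - d%:Z = n%:Z + 1 - d.+1%:Z + 1 by lia.
move: IH0 IH1; rewrite ek; set k := n%:Z + 1 - d.+1%:Z => IH0 IH1.
have kn : 1 <= k <= n%:Z by lia.
have k1 : 1 <= k <= n%:Z + 1 by lia.
have ks1 : 1 <= k + 1 <= n%:Z + 1 by lia.
have [k_ge1 _] := andP k1.
have e := schubert_divdiff (longest_move_Sn ks1) k_ge1 (longest_move_descent kn).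
rewrite (longest_move_stransp kn) in e.
have kk1 : (k == k + 1) = false by lia.
have k1k : (k + 1 == k) = false by lia.
split=> [j hj|].
  (* For j < k, setting x_j = 0 commutes with s_k, so the right side vanishes by induction and x_k -
     x_(k+1) cancels. *)
  have jk : (k == j) = false by lia.
  have jk1 : (k + 1 == j) = false by lia.
  have njk : j != k by lia.
  have njk1 : j != k + 1 by lia.
  have IHj := IH0 j ltac:(lia).
  have := evalm_divdiff (kill j) e.
  rewrite (evalm_kill_rename _ njk njk1) IHj.
  rewrite renameE rmorph0 (subr0 (0 : pol)) {1 2}/kill jk jk1 => {}e.
  have nkk1 : k != k + 1 by rewrite kk1.
  by apply: (mulX_subr_inj nkk1); exact: etrans e (esym (mulr0 _)).
have IHk := IH0 k ltac:(lia).
have := evalm_divdiff (kill k) e.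
rewrite evalm_kill_rename_succ IH1 IHk.
rewrite {1 2}/kill eqxx k1k !sub0r mulNr renameE evalm_staircase => /oppr_inj.
move=> e2.
exact: (@mulX_inj (k + 1) _ _ (etrans e2 (staircase_stransp X kn))).
Qed.

(** Undoes the shift after setting x_1 = 0; it carries the Schubert polynomial of 1 x w to that of
    w. *)
Definition unshift1 (i : int) : pol := if i == 1 then 0 else X (i - 1).

Lemma unshift1E f :
  evalm unshift1 f = rename (fun i => i + -1) (evalm (kill 1) f).
Proof.
rewrite renameE evalm_comp; apply: eq_evalm => i; rewrite /unshift1 /kill /=.
by case: (i == 1); rewrite (rmorph0, evalmX).
Qed.

Lemma unshift1_staircase n :
  evalm unshift1 (Sch (shift_perm 1 (longest n))) = Sch (longest n).
Proof.
(* Taking d = n gives the end k = 1 of the chain. *)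
have [_] := kill_schubert_longest_move (leqnn n).
rewrite addrAC subrr add0r longest_move_first => e.
rewrite unshift1E e renameE evalm_staircase (proj1 hSch) /staircase.
rewrite big_ltn //= mul1r big_add1 /=.
under eq_big_nat => j hj.
  rewrite ifF; last lia.
  rewrite subSS -[j.+1]addn1 PoszD addrK; over.
exact: prod_expn_subn.
Qed.

(** The substitution sends x_(i+1) - x_(i+2) to x_i - x_(i+1) and intertwines s_(i+1) with s_i, so
    the divided difference giving the polynomial of 1 x w becomes the one giving that of w. *)
Lemma schubert_stable n w : in_Sn n w ->
  evalm unshift1 (Sch (shift_perm 1 w)) = Sch w.
Proof.
move: w; apply: in_Sn_ind; first exact: unshift1_staircase.
move=> w i wS hi asc IHw.
have iS := in_Sn_stransp hi.
have wS' := in_Sn_comp wS iS.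
have [i1 _] := andP hi.
have desc : (w \o stransp i) (i + 1) < (w \o stransp i) i.
  rewrite /= /stransp eqxx (_ : (i + 1 == i) = false); last lia.
  by rewrite eqxx.
have e1 := schubert_divdiff wS' i1 desc.
rewrite comp_stranspK in e1.
have sh_comp v : shift_perm 1 (v \o stransp i) = shift_perm 1 v \o stransp (i + 1).
  apply/funext => j; rewrite /shift_perm /stransp /=.
  by do ![case: eqP => ?]; try lia; congr (v _ + 1); lia.
have [m shS] := in_Soo_Sn (in_Soo_shift 1 (in_Sn_Soo wS')).
have i1' : 1 <= i + 1 by lia.
have desc' : shift_perm 1 (w \o stransp i) (i + 1 + 1)
             < shift_perm 1 (w \o stransp i) (i + 1).
  by rewrite /shift_perm !addrK ltrD2r.
have := evalm_divdiff unshift1 (schubert_divdiff shS i1' desc').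
rewrite -sh_comp comp_stranspK IHw.
have -> : evalm unshift1 (rename (stransp (i + 1)) (Sch (shift_perm 1 (w \o stransp i))))
        = rename (stransp i) (Sch (w \o stransp i)).
  rewrite -IHw; apply: evalm_square => j; rewrite /= evalmX /unshift1.
  (* As i >= 1, s_(i+1) fixes x_1, which goes to 0 on both sides. *)
  have [->|j1] := eqVneq j 1.
    have -> : stransp (i + 1) 1 = 1 by rewrite /stransp; do ![case: eqP]; lia.
    by rewrite eqxx rmorph0.
  have ej : stransp (i + 1) j = stransp i (j - 1) + 1.
    by rewrite /stransp; do ![case: eqP]; lia.
  have nj : (stransp (i + 1) j == 1) = false.
    by move: j1; rewrite /stransp; do ![case: eqP]; lia.
  by rewrite nj ej addrK evalmX.
have i11 : (i + 1 == 1) = false by lia.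
have i21 : (i + 1 + 1 == 1) = false by lia.
have nii : i != i + 1 by lia.
rewrite /unshift1 i11 i21 !addrK -e1; exact: mulX_subr_inj.
Qed.

(** As m omits x_0, its shift omits x_1 and is unaffected by setting x_1 = 0. *)
Lemma mcoeff_schubert_shift1 w (m : mon) : in_Soo w -> m 0 = 0%N ->
  (Sch (shift_perm 1 w))@_(shift_mon 1 m) = (Sch w)@_m.
Proof.
move=> /in_Soo_Sn[n wS] m0; rewrite -(schubert_stable wS) unshift1E.
rewrite -{2}[m]shift_mon0 -(addrN 1) -shift_monD mcoeff_rename_shift.
by rewrite mcoeff_kill // shift_monE subrr.
Qed.

Definition pos_mon (m : mon) : Prop := forall i : int, i <= 0 -> m i = 0%N.

Lemma pos_mon_shift (k : nat) m : pos_mon m -> pos_mon (shift_mon k%:Z m).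
Proof. by move=> pm i i0; rewrite shift_monE pm //; lia. Qed.

Lemma mcoeff_schubert_shift (k : nat) w m : in_Soo w -> pos_mon m ->
  (Sch (shift_perm k%:Z w))@_(shift_mon k%:Z m) = (Sch w)@_m.
Proof.
move=> wS pm; elim: k => [|k IHk].
  rewrite shift_mon0; congr (mcoeff _ (Sch _)).
  by apply/funext => i; rewrite /shift_perm subr0 addr0.
rewrite -IHk -addn1 PoszD -shift_permD -shift_monD mcoeff_schubert_shift1 //.
  exact: in_Soo_shift.
exact: pos_mon_shift.
Qed.

(** * Coefficients of the back stable and Stanley limits *)

Lemma coef_lim_eq (P : nat -> Prop) u m c (N : nat) :
  (forall k, (N <= k)%N -> P k) -> (forall k, (N <= k)%N -> (u k)@_m = c) ->
  coef_lim P u m = c.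
Proof.
move=> PN uN; apply: xget_unique => [|c' [N' uN']].
  by exists N => k Nk _; apply: uN.
rewrite -(uN' (maxn N N')) ?leq_maxr ?uN //; last apply: PN; exact: leq_maxl.
Qed.

(** By stability the sequence of coefficients is constant from k on, so the limit is already reached
    there. *)
Lemma back_stable_coef w (k : nat) m : in_Soo (shift_perm k%:Z w) ->
  pos_mon (shift_mon k%:Z m) ->
  back_stable Sch w m = (Sch (shift_perm k%:Z w))@_(shift_mon k%:Z m).
Proof.
move=> wS pm; apply: (@coef_lim_eq _ _ _ _ k) => l kl.
  by have := in_Soo_shift (l - k) wS; rewrite shift_permD -PoszD subnKC.
rewrite -{1}[m]shift_mon0 -(subrr l%:Z) -shift_monD mcoeff_rename_shift.
rewrite -(mcoeff_schubert_shift (l - k) wS pm) shift_permD shift_monD.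
by rewrite -PoszD subnKC.
Qed.

(** For large k, the k-th term of the limit [stanley] has at m the coefficient that [back_stable]
    has at gamma^(-k) m. *)
Lemma stanley_back_stable w m c (N : nat) : in_SZ w -> pos_mon m ->
  (forall k : nat, (N <= k)%N -> back_stable Sch w (shift_mon (- k%:Z) m) = c) ->
  stanley Sch w m = c.
Proof.
move=> wSZ pm lim; have [K wK] := in_Soo_shift_near wSZ.
apply: (@coef_lim_eq _ _ _ _ (maxn K N)) => k; rewrite geq_max => /andP[Kk Nk].
  exact: wK.
rewrite -(lim k Nk) (back_stable_coef (wK k Kk)) shift_monD addNr shift_mon0 //.
Qed.

End SchubertStability.

(* Truncation of series to finitely many variables *)
(* From here on [_@_ _], [mdeg] and ['X_{1..N}] are those of mpoly. *)
From mathcomp.multinomials Require Import mpoly.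

(* The monomial x_(1-s)^mu_0 ... x_(N-s)^mu_(N-1). *)
Definition embed_mnm (N s : nat) (mu : 'X_{1..N}) : mon :=
  \big[mmul/mone]_(j < N) \big[mmul/mone]_(0 <= l < mu j) ucm (j%:Z + 1 - s%:Z).

Lemma embed_mnmE N s (mu : 'X_{1..N}) i :
  embed_mnm s mu i = (\sum_(j < N) mu j * (j%:Z + 1 - s%:Z == i)%R)%N.
Proof.
rewrite /embed_mnm cm_bigE; apply: eq_bigr => j _.
by rewrite cm_bigE sum_nat_const_nat subn0 cmU.
Qed.

Lemma embed_mnm_ord N s (mu : 'X_{1..N}) (j : 'I_N) :
  embed_mnm s mu (j%:Z + 1 - s%:Z) = mu j.
Proof.
rewrite embed_mnmE (bigD1 j) //= eqxx muln1 big1 ?addn0 // => l lj.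
rewrite (_ : (_ == _) = false) ?muln0 //; apply/eqP => e; move/eqP: lj; apply.
by apply: val_inj => /=; lia.
Qed.

Lemma embed_mnm_out N s (mu : 'X_{1..N}) (i : int) :
  ~~ (1 <= i + s%:Z <= N%:Z) -> embed_mnm s mu i = 0%N.
Proof.
move=> hi; rewrite embed_mnmE big1 // => j _; have lj := ltn_ord j.
have -> : (j%:Z + 1 - s%:Z == i) = false by lia.
exact: muln0.
Qed.

Lemma embed_ordP N s (i : int) : 1 <= i + s%:Z <= N%:Z ->
  exists j : 'I_N, i = j%:Z + 1 - s%:Z.
Proof.
move=> hi; have lt : (`|(i + s%:Z - 1)%R|%N < N)%N by lia.
by exists (Ordinal lt) => /=; lia.
Qed.

Lemma embed_mnm_eqP N s (m : mon) (mu : 'X_{1..N}) :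
  (forall i : int, ~~ (1 <= i + s%:Z <= N%:Z) -> m i = 0%N) ->
  (forall j : 'I_N, m (j%:Z + 1 - s%:Z) = mu j) ->
  m = embed_mnm s mu.
Proof.
move=> mout mord; apply/eqP/cmP => i.
have [hi|hi] := boolP (1 <= i + s%:Z <= N%:Z).
  by have [j ->] := embed_ordP hi; rewrite mord embed_mnm_ord.
by rewrite mout // embed_mnm_out.
Qed.

Lemma embed_mnm_inj N s : injective (@embed_mnm N s).
Proof.
by move=> mu nu e; apply/mnmP => j; rewrite -!(embed_mnm_ord s) e.
Qed.

Lemma embed_mnm0 N s : embed_mnm s (0%MM : 'X_{1..N}) = mone.
Proof.
by apply/esym/embed_mnm_eqP => [i _|j]; rewrite cm1 ?mnm0E.
Qed.

Lemma embed_mnmD N s (mu nu : 'X_{1..N}) :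
  embed_mnm s (mu + nu)%MM = mmul (embed_mnm s mu) (embed_mnm s nu).
Proof.
apply/esym/embed_mnm_eqP => [i hi|j]; rewrite cmM; first by rewrite !embed_mnm_out.
by rewrite !embed_mnm_ord mnmDE.
Qed.

(** A divisor of a monomial in the window of variables stays in the window, which makes truncation
    compatible with the Cauchy product. *)
Lemma embed_mnm_factor N s (mu : 'X_{1..N}) a b : mmul a b = embed_mnm s mu ->
  exists mu1 mu2, [/\ a = embed_mnm s mu1, b = embed_mnm s mu2 & mu = (mu1 + mu2)%MM].
Proof.
move=> e; have ab i : (a i + b i)%N = embed_mnm s mu i by rewrite -e cmM.
have ha : a = embed_mnm s [multinom a (j%:Z + 1 - s%:Z)%R | j < N].
  apply: embed_mnm_eqP => [i hi|j]; last by rewrite mnmE.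
  by have := ab i; rewrite embed_mnm_out //; lia.
have hb : b = embed_mnm s [multinom b (j%:Z + 1 - s%:Z)%R | j < N].
  apply: embed_mnm_eqP => [i hi|j]; last by rewrite mnmE.
  by have := ab i; rewrite embed_mnm_out //; lia.
do 2!eexists; split; [exact: ha | exact: hb |].
by apply/mnmP => j; rewrite mnmDE !mnmE ab embed_mnm_ord.
Qed.

Lemma mdeg_embed N s (mu : 'X_{1..N}) : monalg.mdeg (embed_mnm s mu) = mdeg mu.
Proof.
rewrite /embed_mnm monalg.mdeg_prod mdegE; apply: eq_bigr => j _.
by rewrite monalg.mdeg_prod (eq_bigr (fun=> 1%N)) => [|l _];
  rewrite ?sum_nat_const_nat ?subn0 ?muln1 ?monalg.mdegU.
Qed.

Lemma embed_mnm_shift N s (mu : 'X_{1..N}) :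
  shift_mon (- s%:Z) (embed_mnm 0 mu) = embed_mnm s mu.
Proof.
apply: embed_mnm_eqP => [i hi|j]; rewrite shift_monE.
  by rewrite embed_mnm_out //; lia.
by rewrite opprK subrK -[_ + 1]subr0 embed_mnm_ord.
Qed.

(* p is the specialization of f at x_i = 0 for i outside [1-s, N-s]. *)
Definition truncates (N s : nat) (f : series) (p : mpoly N rat) : Prop :=
  forall mu, f (embed_mnm s mu) = p@_mu.

Lemma truncates_one N s : @truncates N s sone 1.
Proof.
move=> mu; rewrite /sone mcoeff1 -(embed_mnm0 N s); congr (nat_of_bool _)%:R.
by apply/eqP/eqP => [/embed_mnm_inj|->].
Qed.

Lemma truncates_mul N s f g (p q : mpoly N rat) :
  truncates s f p -> truncates s g q -> truncates s (smul f g) (p * q).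
Proof.
move=> fp gq mu; rewrite /smul mcoeffM.
pose h (k : 'X_{1..N < (mdeg mu).+1, (mdeg mu).+1}) : mon * mon :=
  (embed_mnm s k.1, embed_mnm s k.2).
(* [mcoeffM] sums over pairs of multinomials of bounded degree; [r] lists the corresponding pairs of
   monomials, which are all the factorizations. *)
pose r := [seq h k | k <- enum [pred k : 'X_{1..N < (mdeg mu).+1, (mdeg mu).+1} |
                               mu == (k.1 + k.2)%MM]].
have r_uniq : uniq r.
  rewrite map_inj_uniq ?enum_uniq // => -[k1 k2] [l1 l2] [].
  by move=> /embed_mnm_inj/val_inj -> /embed_mnm_inj/val_inj ->.
have -> : [set ab : mon * mon | mmul ab.1 ab.2 = embed_mnm s mu] = [set` r].
  apply/seteqP; split=> [[a b] /= /embed_mnm_factor[mu1 [mu2 [-> -> emu]]]|].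
    have lt1 : (mdeg mu1 < (mdeg mu).+1)%N by rewrite emu mdegD ltnS leq_addr.
    have lt2 : (mdeg mu2 < (mdeg mu).+1)%N by rewrite emu mdegD ltnS leq_addl.
    apply/mapP; exists (BMultinom lt1, BMultinom lt2) => //.
    by rewrite mem_enum inE /= emu.
  move=> ab /= /mapP[k]; rewrite mem_enum inE => /eqP emu ->.
  by rewrite /h /= -embed_mnmD -emu.
rewrite -fsbig_seq // big_map big_enum /=.
by apply: eq_bigr => k _; rewrite /h /= fp gq.
Qed.

(** A monomial of the window does not see the other variables, so only P on the window matters. Here
    e_d in the x_j with j <= i becomes an ordinary elementary polynomial. *)
Lemma truncates_elem N s (P : pred int) d :
  (forall j : 'I_N, P (j%:Z + 1 - s%:Z)) ->
  truncates s (elem P d) (mesym N rat d).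
Proof.
move=> hP mu; rewrite /elem mcoeff_mesym mdeg_embed; congr (nat_of_bool (_ && _))%:R.
apply/allP/forallP => [h j|h i].
  rewrite leqNgt; apply/negP => mj.
  have /h : j%:Z + 1 - s%:Z \in finsupp (embed_mnm s mu).
    by rewrite -cmE_neq0 embed_mnm_ord; lia.
  by rewrite embed_mnm_ord => /andP[_ /eqP]; lia.
rewrite -cmE_neq0; have [hi|hi] := boolP (1 <= i + s%:Z <= N%:Z); last first.
  by rewrite embed_mnm_out.
have [j ->] := embed_ordP hi; rewrite embed_mnm_ord hP /= => muj.
by have := h j; lia.
Qed.

Lemma truncates_prod N s (I : eqType) (r : seq I) (F : I -> series)
    (G : I -> mpoly N rat) : (forall i, i \in r -> truncates s (F i) (G i)) ->
  truncates s (\big[smul/sone]_(i <- r) F i) (\prod_(i <- r) G i).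
Proof.
elim: r => [|i r IHr] FG; first by rewrite !big_nil; apply: truncates_one.
rewrite !big_cons; apply: truncates_mul; first by apply: FG; rewrite mem_head.
by apply: IHr => j rj; apply: FG; rewrite in_cons rj orbT.
Qed.

Lemma leq_bigmax_mem (T : eqType) (r : seq T) (F : T -> nat) x :
  x \in r -> (F x <= \max_(y <- r) F y)%N.
Proof. by move=> xr; apply: (@leq_bigmax_seq _ r xpredT). Qed.

(** * Partitions as exponent vectors in the elementary polynomials *)

Definition elem_part (N : nat) (s : seq nat) : mpoly N rat :=
  \prod_(d <- s) mesym N rat d.

(** Exponents of the monomial that becomes the product of the e_d, d in s, when the variable of
    index j is replaced by e_(j+1). *)
Definition part_mnm (N : nat) (s : seq nat) : 'X_{1..N} :=
  [multinom count_mem j.+1 s | j < N].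

Lemma elem_part_comp N s : all (fun d => 0 < d <= N)%N s ->
  elem_part N s = 'X_[part_mnm N s] \mPo [tuple mesym N rat j.+1 | j < N].
Proof.
elim: s => [|d s IHs] /=.
  by rewrite /elem_part big_nil (_ : part_mnm N [::] = 0%MM) ?mpolyX0 ?comp_mpoly1 //.
move=> /andP[/andP[d0 dN] sN]; rewrite /elem_part big_cons -[X in _ * X]/(elem_part N s).
have lt : (d.-1 < N)%N by rewrite prednK.
have -> : part_mnm N (d :: s) = (U_(Ordinal lt) + part_mnm N s)%MM.
  apply/mnmP => j; rewrite mnmDE mnm1E !mnmE /=; congr (nat_of_bool _ + _)%N.
  by apply/eqP/eqP => [e|<-]; [apply: val_inj; rewrite /= e | rewrite /= prednK].
rewrite mpolyXD rmorphM /= -IHs //; congr (_ * _).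
by rewrite comp_mpolyXU -tnth_nth tnth_mktuple /= prednK.
Qed.

(** Parts between 1 and N are all counted by the exponents, so equal exponents mean equal multisets,
    and a multiset has a single weakly decreasing arrangement. *)
Lemma part_mnm_eq N s t : all (fun d => 0 < d <= N)%N s ->
  all (fun d => 0 < d <= N)%N t -> sorted geq t ->
  (part_mnm N s == part_mnm N t) = (sort geq s == t).
Proof.
move=> sN tN tS.
have geq_anti : antisymmetric geq by move=> x y /=; lia.
have geq_trans : transitive geq by move=> x y z /= h1 h2; apply: leq_trans h2 h1.
have geq_tot : total geq by move=> x y /=; lia.
have -> : (sort geq s == t) = perm_eq s t.
  rewrite -(perm_sort geq s); apply/eqP/idP => [->//|].
  apply: (sorted_eq geq_trans geq_anti) => //; exact: sort_sorted.
apply/eqP/idP => [/mnmP e|/permP e]; last by apply/mnmP => j; rewrite !mnmE e.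
rewrite /perm_eq; apply/allP => d; rewrite mem_cat => dst /=.
have /andP[d0 dN] : (0 < d <= N)%N by case/orP: dst; [apply: (allP sN) | apply: (allP tN)].
have lt : (d.-1 < N)%N by rewrite prednK.
by have := e (Ordinal lt); rewrite !mnmE /= prednK // => ->.
Qed.

Lemma intpart_all_gt0 (lam : intpart) d : d \in val lam -> (0 < d)%N.
Proof.
by move=> dl; rewrite lt0n; apply/eqP => d0; case/andP: (valP lam); rewrite -d0 dl.
Qed.

Definition tuple_parts (alpha : tuples) : seq nat :=
  [seq alpha i | i <- finsupp alpha].

Lemma tuple_parts_gt0 alpha d : d \in tuple_parts alpha -> (0 < d)%N.
Proof. by case/mapP => i; rewrite mem_finsupp lt0n => ? ->. Qed.

(** * Truncations of the two expansions *)

Lemma truncates_e_part N lam : truncates 0 (e_part lam) (elem_part N (val lam)).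
Proof. by apply: truncates_prod => d _; apply: truncates_elem => j; lia. Qed.

(** The window ends at N - s, not above any index of the support, so each factor involves all the
    variables of the window. *)
Lemma truncates_sem N (s : nat) (alpha : tuples) :
  (forall i, i \in finsupp alpha -> N%:Z - s%:Z <= i) ->
  truncates s (sem alpha) (elem_part N (tuple_parts alpha)).
Proof.
move=> hs; rewrite /elem_part big_map /sem.
apply: truncates_prod => i hi; apply: truncates_elem => j.
by have := hs i hi; have := ltn_ord j; lia.
Qed.

(** Shifting down by a large k moves x_1, ..., x_N below the supports of all the alpha that occur,
    where every SEM truncates to a product of elementary polynomials independent of k. *)
Lemma stanley_truncates Sch w (kappa : {fsfun tuples -> rat with 0}) N :
  schubert_family Sch -> in_SZ w -> back_stable Sch w = lincomb sem kappa ->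
  truncates 0 (stanley Sch w)
    (\sum_(alpha <- finsupp kappa) kappa alpha *: elem_part N (tuple_parts alpha)).
Proof.
move=> hSch wSZ hk mu.
(* B bounds the indices in all supports; the window ends at N - k <= -B once k >= N + B. *)
have [B hB] : exists B : nat, forall alpha, alpha \in finsupp kappa ->
    forall i, i \in finsupp alpha -> (`|i| <= B)%N.
  exists (\max_(alpha <- finsupp kappa) \max_(i <- finsupp alpha) `|i|)%N.
  move=> alpha ha i hi; apply: leq_trans
    (@leq_bigmax_mem _ (enum_fset (finsupp kappa))
      (fun alpha : tuples => \max_(i <- finsupp alpha) `|i|%N) _ ha).
  exact: (@leq_bigmax_mem _ (enum_fset (finsupp alpha)) (fun i : int => `|i|%N)).
apply: (stanley_back_stable (N := (N + B)%N) hSch wSZ) => [i i0|k Kk].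
  by rewrite embed_mnm_out //; lia.
rewrite embed_mnm_shift hk /lincomb raddf_sum; apply: eq_big_seq => alpha ha /=.
rewrite mcoeffZ (@truncates_sem N k) // => i hi.
by have := hB _ ha _ hi; lia.
Qed.

(** * Comparison of the coefficients at a partition *)

Theorem theorem1p3
  (Sch : (int -> int) -> pol) (hSch : schubert_family Sch)
  (w : int -> int) (hw : in_SZ w)
  (kappa : {fsfun tuples -> rat with 0})
  (hkappa : back_stable Sch w = lincomb sem kappa)
  (c : {fsfun intpart -> rat with 0})
  (hc : stanley Sch w = lincomb e_part c)
  (lam : intpart) :
  \sum_(alpha \in Orb lam) kappa alpha = c lam.
Proof.
(* N bounds every part that occurs in kappa, c and lam, so that exponent vectors of length N record
   all of them; a sum of maxima serves as a common bound. *)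
have [N [Nk Nc Nlam]] : exists N : nat,
  [/\ forall alpha, alpha \in finsupp kappa ->
        all (fun d => 0 < d <= N)%N (tuple_parts alpha),
      forall mu, mu \in finsupp c -> all (fun d => 0 < d <= N)%N (val mu) &
      all (fun d => 0 < d <= N)%N (val lam)].
  pose M (s : seq nat) := \max_(d <- s) d.
  have hM d s : d \in s -> (d <= M s)%N.
    exact: (leq_bigmax_mem id).
  exists (\max_(alpha <- finsupp kappa) M (tuple_parts alpha)
          + \max_(mu <- finsupp c) M (val mu) + M (val lam))%N.
  split=> [alpha ha|mu hmu|]; apply/allP => d hd.
  - rewrite (tuple_parts_gt0 hd) -addnA; apply: leq_trans (leq_addr _ _).
    apply: leq_trans (hM _ _ hd) _.
    exact: (@leq_bigmax_mem _ (enum_fset (finsupp kappa))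
      (fun alpha : tuples => M (tuple_parts alpha))).
  - rewrite (intpart_all_gt0 hd) addnAC; apply: leq_trans (leq_addl _ _).
    apply: leq_trans (hM _ _ hd) _.
    exact: (@leq_bigmax_mem _ (enum_fset (finsupp c))
      (fun mu : intpart => M (val mu))).
  - by rewrite (intpart_all_gt0 hd); apply: leq_trans (leq_addl _ _); apply: hM.
(* Algebraic independence: an equality after substituting the elementary polynomials holds before
   it, and coefficients at lam can be compared. *)
have /msym_fundamental_un /(congr1 (mcoeff (part_mnm N (val lam)))) :
    (\sum_(alpha <- finsupp kappa) kappa alpha *: 'X_[part_mnm N (tuple_parts alpha)])
      \mPo [tuple mesym N rat j.+1 | j < N] =
    (\sum_(mu <- finsupp c) c mu *: 'X_[part_mnm N (val mu)])
      \mPo [tuple mesym N rat j.+1 | j < N].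
  rewrite !raddf_sum /=.
  under eq_big_seq => alpha ha do rewrite linearZ /= -elem_part_comp ?Nk //.
  under [RHS]eq_big_seq => mu hmu do rewrite linearZ /= -elem_part_comp ?Nc //.
  (* Both sides are F_w truncated to N variables. *)
  apply/mpolyP => mu; rewrite -(stanley_truncates hSch hw hkappa mu) hc /lincomb.
  rewrite raddf_sum; apply: eq_bigr => nu _ /=.
  by rewrite mcoeffZ truncates_e_part.
have lam_sorted : sorted geq (val lam) by case/andP: (valP lam).
rewrite !raddf_sum /=.
under eq_big_seq => alpha ha do
  rewrite mcoeffZ mcoeffX (part_mnm_eq (Nk _ ha) Nlam lam_sorted).
under [RHS]eq_big_seq => mu hmu do
  rewrite mcoeffZ mcoeffX (part_mnm_eq (Nc _ hmu) Nlam lam_sorted).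
move=> e.
have -> : Orb lam = [set` [pred alpha : tuples | sort geq (tuple_parts alpha) == val lam]].
  by apply/seteqP; split=> alpha /= /eqP.
(* The orbit may be infinite; the sum reduces to the finite support of kappa. *)
rewrite -(@bigfs _ _ _ _ (enum_fset (finsupp kappa))) ?fset_uniq //; last first.
  by move=> alpha _; exact: fsfun_dflt.
rewrite big_mkcond /=.
transitivity (\sum_(alpha <- finsupp kappa)
   kappa alpha * (sort geq (tuple_parts alpha) == val lam)%:R).
  by apply: eq_bigr => alpha _; case: (_ == _); rewrite ?mulr1 ?mulr0.
rewrite e; transitivity (\sum_(mu <- finsupp c) c mu * (mu == lam)%:R).
  apply: eq_bigr => mu _; rewrite sorted_sort //; last by case/andP: (valP mu).
  by move=> x y z /= h1 h2; apply: leq_trans h2 h1.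
have [lamc|lamNc] := boolP (lam \in finsupp c).
  rewrite (bigD1_seq lam) ?fset_uniq //= eqxx mulr1 big1 ?addr0 // => mu.
  by move=> /negbTE ->; rewrite mulr0.
(* Outside the support of c, the value at lam is the default 0 and no term of the sum matches
   lam. *)
rewrite (fsfun_dflt lamNc) big1_seq // => mu /= muc.
case: eqP => [emu|]; last by rewrite mulr0.
by rewrite -emu muc in lamNc.
Qed.
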